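(* If $G\in\mathcal{H}$, then $G$ has the planar shrink property.
   Context: Plane graphs. An arc is a subset of $\mathbb{R}^2$ that is the union of finitely many segments and is homeomorphic to the closed interval $[0,1]$; the images of $0$ and $1$ under such a homeomorphism are its endpoints, and its interior is the arc minus its two endpoints. A plane graph is a pair $G=(V,E)$ such that: $V\subset\mathbb{R}^2$ is at most countable; every edge is an arc between two vertices; different edges have different sets of endpoints; the interior of an edge contains no vertex and no point of any other edge. Degrees. For $v\in V$ and $S\subset V$, $deg_S(v)$ is the number of neighbours of $v$ lying in $S$, i.e. $deg_S(v)=|\{u\in S:\{u,v\}\in E\}|$. The degree of $v$ is $deg(v)=deg_V(v)$, and the maximum degree of $G$ is $\Delta(G)=\sup\{deg(v):v\in V\}$. The class $\mathcal{H}$ is the collection of infinite plane graphs $G=(V,E)$ satisfying the following properties: (P1) every edge is a closed line segment, i.e. a line segment which includes its two endpoints; (P2) for each $e\in E$, consider the unique straight line $\ell$ which contains $e$; then for any $x\in\ell$ there exists $f\in E$ such that $x\in f$; (P3) $\Delta(G)<\infty$. Planar shrink property. For a line $\ell$ in $\mathbb{R}^2$, let $H_1^\ell,H_2^\ell\subset\mathbb{R}^2$ be the two closed half-planes having $\ell$ as boundary, and for a non-empty $S\subset V$ let $S_i^\ell=S\cap H_i^\ell$ for $i=1,2$. A plane graph $G=(V,E)$ has the planar shrink property when, for any non-empty set $S\subset V$ and for any line $\ell$, one has, for $i=1,2$: if $S_i^\ell$ is non-empty and has finite cardinality, then there exists $u\in S_i^\ell$ such that $deg_{V\setminus S}(u)\geq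 deg_S(u)$.
   Formalization: The formal theorem also assumes that every vertex is an isolated point of V; without it the claim fails, e.g. for vertices 0, 1, -2^k, 1+2^k (k in Z) on the x-axis with consecutive ones joined, and S={0,1}. *)

(* Defs.v *)
From HB Require Import structures.
From mathcomp Require Import all_boot all_order all_algebra.
From mathcomp Require Import all_classical all_reals all_analysis.
Import Order.TTheory GRing.Theory Num.Theory.
Import numFieldNormedType.Exports.

Set Implicit Arguments.
Unset Strict Implicit.
Unset Printing Implicit Defensive.

Local Open Scope classical_set_scope.
Local Open Scope ring_scope.

Notation plane R := 'rV[R]_2.

Definition segment (R : realType) (a b : plane R) : set (plane R) :=
  [set (1 - t) *: a + t *: b | t in `[0, 1]%classic].

(* A is a finite union of segments, and f is a homeomorphism, with inverse g,
   from [0, 1] onto A such that f 0 = x and f 1 = y. *)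
Definition arc_between (R : realType) (A : set (plane R)) (x y : plane R)
    : Prop :=
  (exists s : seq (plane R * plane R),
     A = \bigcup_(p in [set` s]) segment p.1 p.2) /\
  exists (f : R -> plane R) (g : plane R -> R),
    [/\ f @` `[0, 1] = A,
        {in `[0, 1], cancel f g},
        {within `[0, 1], continuous f},
        {within A, continuous g}
      & f 0 = x /\ f 1 = y].

Definition endpoints (R : realType) (A : set (plane R)) : set (plane R) :=
  [set x | exists y, arc_between A x y \/ arc_between A y x].

Definition arc_interior (R : realType) (A : set (plane R)) : set (plane R) :=
  A `\` endpoints A.

Record plane_graph (R : realType) := PlaneGraph {
  vertices : set (plane R);
  edges : set (set (plane R));
  countable_vertices : countable vertices;
  edges_arc : forall e, edges e ->
    exists x y, [/\ vertices x, vertices y & arc_between e x y];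
  endpoints_inj : forall e f, edges e -> edges f ->
    endpoints e = endpoints f -> e = f;
  interior_vertices : forall e, edges e ->
    arc_interior e `&` vertices = set0;
  interior_edges : forall e f, edges e -> edges f -> e <> f ->
    arc_interior e `&` f = set0 }.

(* {u, v} is an edge: some edge has endpoint set {u, v}. *)
Definition adjacent (R : realType) (G : plane_graph R) (u v : plane R) : Prop :=
  exists2 e, edges G e & endpoints e = [set u; v].

(* Valued in \bar R, so that infinite degrees are +oo. *)
Definition deg (R : realType) (G : plane_graph R) (S : set (plane R))
    (v : plane R) : \bar R :=
  counting [set u | S u /\ adjacent G u v].

Definition max_degree (R : realType) (G : plane_graph R) : \bar R :=
  ereal_sup [set deg G (vertices G) v | v in vertices G].

Definition dotp (R : realType) (n x : plane R) : R := (n *m x^T) 0 0.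

Definition is_line (R : realType) (l : set (plane R)) : Prop :=
  exists n c, n != 0 /\ l = [set x | dotp n x = c].

(* H is one of the two closed half-planes with boundary l; replacing (n, c) by
   (- n, - c) gives the other one. *)
Definition closed_half_plane (R : realType) (l H : set (plane R)) : Prop :=
  exists n c, [/\ n != 0, l = [set x | dotp n x = c]
                & H = [set x | c <= dotp n x]].

Record class_H (R : realType) (G : plane_graph R) : Prop := ClassH {
  H_infinite : infinite_set (vertices G);
  H_segment : forall e, edges G e -> exists a b, e = segment a b;
  H_line : forall e l, edges G e -> is_line l -> e `<=` l ->
    forall x, l x -> exists2 f, edges G f & f x;
  H_degree : (max_degree G < +oo)%E }.

(* No vertex is a limit of other vertices. This is not implied by class_H: take
   the vertices (0, 0), (1, 0), (- 2 ^ k, 0), (1 + 2 ^ k, 0), k an integer, with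
   an edge between any two that are consecutive on the x-axis. There (0, 0) and
   (1, 0) are each other's only neighbour, and planar_shrink fails. *)
Definition discrete_vertices (R : realType) (G : plane_graph R) : Prop :=
  forall v, vertices G v -> isolated (vertices G) v.

Definition planar_shrink (R : realType) (G : plane_graph R) : Prop :=
  forall (S : set (plane R)) (l H : set (plane R)),
    S `<=` vertices G -> S !=set0 -> is_line l -> closed_half_plane l H ->
    S `&` H !=set0 -> finite_set (S `&` H) ->
    exists2 u, (S `&` H) u & (deg G S u <= deg G (vertices G `\` S) u)%E.

(* Main.v *)
(* Take a vertex u of S in the half-plane H that is lexicographically maximal,
   first for the inner normal n of H, then for the orthogonal direction.  By
   (P2) and discreteness, a neighbour w of u has an opposite neighbour u + s (u - w),
   s > 0.  If w is in S then this opposite neighbour is beyond u, hence in H but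
   not in S, so w |-> u + s (u - w) injects the neighbours of u in S into those
   outside S.

   (P2) only says that each point of the line is on some edge, possibly one that
   crosses the line.  But there are countably many edges, and each of the
   crossing ones meets the line in at most one point, so points arbitrarily close
   to u lie on edges contained in the line. *)
Require Import Defs.
From mathcomp Require Import all_boot all_order all_algebra.
From mathcomp Require Import all_classical all_reals all_analysis.
From mathcomp Require Import ring lra.
Import Order.TTheory GRing.Theory Num.Theory.
Import numFieldNormedType.Exports.
(* Imported again because MathComp-Analysis has another [adjacent]. *)
Import Defs.

Set Implicit Arguments.
Unset Strict Implicit.
Unset Printing Implicit Defensive.

Local Open Scope classical_set_scope.
Local Open Scope ring_scope.

(** * Coordinates and dot products in the plane *)

Lemma dotpE (R : realType) (n x : plane R) :
  dotp n x = n 0 0 * x 0 0 + n 0 1 * x 0 1.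
Proof.
rewrite /dotp mxE !big_ord_recl big_ord0 addr0 !mxE.
by congr (_ * _ + _ * _); congr (_ _ _); apply/val_inj.
Qed.

Lemma rV2P (R : realType) (x y : plane R) :
  x 0 0 = y 0 0 -> x 0 1 = y 0 1 -> x = y.
Proof.
move=> h0 h1; apply/rowP => i; case: (unliftP 0 i) => [j ->|->//].
by rewrite (_ : lift 0 j = 1)//; apply/val_inj; rewrite [j]ord1.
Qed.

Lemma dotp_gt0 (R : realType) (n : plane R) : n != 0 -> 0 < dotp n n.
Proof.
move=> n0; rewrite lt_neqAle dotpE -!expr2 addr_ge0 ?sqr_ge0// andbT eq_sym.
apply: contra n0; rewrite paddr_eq0 ?sqr_ge0// !sqrf_eq0.
move=> /andP[/eqP h0 /eqP h1].
by apply/eqP/rV2P; rewrite mxE.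
Qed.

Lemma dotp_continuous (R : realType) (n : plane R) : continuous (dotp n).
Proof.
have -> : dotp n = (fun x => n 0 0 * x 0 0 + n 0 1 * x 0 1).
  by apply/funext => x; rewrite dotpE.
have c j k : continuous (fun x : plane R => k * x 0 j).
  by move=> x; exact: (cvgMl_tmp (@coord_continuous _ _ _ 0 j x)).
by move=> x; exact: cvgD (c _ _ x) (c _ _ x).
Qed.

(** * Endpoints of segments seen as arcs *)

(** This makes the endpoints of an arc independent of its parametrisation: two parametrisations
    differ by such an [h]. *)
Lemma homeo_unit_interval_end (R : realType) (h : R -> R) (t : R) :
  {within `[0, 1], continuous h} -> {in `[0, 1] &, injective h} ->
  h @` `[0, 1] = `[0, 1]%classic -> t = 0 \/ t = 1 -> h t = 0 \/ h t = 1.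
Proof.
move=> hc hi him tE.
have t01 : t \in `[0, 1]%R.
  by rewrite in_itv/=; case: tE => ->; apply/andP; split; lra.
have : `[0, 1]%classic (h t) by rewrite -him; exists t.
rewrite /= in_itv/= => /andP[ht0 ht1].
have [t0 t0I ht0E] : exists2 s : R, s \in `[0, 1]%R & h s = 0.
  have : (h @` `[0, 1]) 0 by rewrite him /= in_itv/= lexx ler01.
  by case=> s; exists s.
have [t1 t1I ht1E] : exists2 s : R, s \in `[0, 1]%R & h s = 1.
  have : (h @` `[0, 1]) 1 by rewrite him /= in_itv/= lexx ler01.
  by case=> s; exists s.
have [tt0|tt0] := eqVneq t t0; first by left; rewrite tt0.
have [tt1|tt1] := eqVneq t t1; first by right; rewrite tt1.
(* t is an end of [0, 1], so it is not between the preimages t0 and t1, and the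
   intermediate value theorem would give h t a second preimage. *)
have [c cI hcE] : exists2 c : R,
    c \in `[Num.min t0 t1, Num.max t0 t1] & h c = h t.
  apply: IVT; first by rewrite ge_min !le_max !lexx.
    apply: continuous_subspaceW hc => s /=; rewrite !in_itv/=.
    move: t0I t1I; rewrite !in_itv/= => /andP[? ?] /andP[? ?] /andP[].
    by rewrite ge_min le_max => /orP[] ? /orP[] ?; apply/andP; split; lra.
  by rewrite /Num.min /Num.max; case: (ltP t0 t1); rewrite ht0E ht1E => _;
    case: ltP => ?; apply/andP; split; lra.
have cE : c = t.
  apply: hi => //; move: cI t0I t1I; rewrite !in_itv/= => /andP[].
  by rewrite ge_min le_max => /orP[] ? /orP[] ? /andP[? ?] /andP[? ?];
    apply/andP; split; lra.
clear him; move: cI t0I t1I tt0 tt1; rewrite cE !in_itv/= ge_min le_max !neq_lt.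
by case: tE => -> /andP[/orP[] ? /orP[] ?] /andP[? ?] /andP[? ?] /orP[] ?
  /orP[] ?; exfalso; lra.
Qed.

Lemma segment_sym (R : realType) (a b : plane R) : segment a b = segment b a.
Proof.
suff sub x y : @segment R x y `<=` segment y x.
  by apply/seteqP; split; exact: sub.
move=> _ [t It <-]; move: It; rewrite /= in_itv/= => /andP[t0 t1].
exists (1 - t) => /=.
  by rewrite in_itv/=; apply/andP; split; lra.
by rewrite subKr addrC.
Qed.

(** The affine parameter of the orthogonal projection of x on the line through a and b. Being
    defined on the whole plane, it is a continuous left inverse of the parametrisation of the
    segment. *)
Definition segment_coord (R : realType) (a b x : plane R) : R :=
  dotp (b - a) (x - a) / dotp (b - a) (b - a).

Lemma segment_coordK (R : realType) (a b : plane R) (t : R) : a != b ->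
  segment_coord a b ((1 - t) *: a + t *: b) = t.
Proof.
move=> ab; rewrite /segment_coord.
have /dotp_gt0/lt0r_neq0 : b - a != 0 by rewrite subr_eq0 eq_sym.
by rewrite !dotpE !mxE => h; field.
Qed.

Lemma segment_coord_continuous (R : realType) (a b : plane R) :
  continuous (segment_coord a b).
Proof.
have -> : segment_coord a b = (fun x =>
    (dotp (b - a) x - dotp (b - a) a) / dotp (b - a) (b - a)).
  by apply/funext => x; rewrite /segment_coord !dotpE !mxE; congr (_ / _); ring.
move=> x; have Fx := nbhs_filter x.
apply: (@cvgMr_tmp _ _ _ Fx); apply: (@cvgB _ _ _ _ Fx); last exact: cvg_cst.
exact: dotp_continuous.
Qed.

Lemma arc_between_segment (R : realType) (a b : plane R) : a != b ->
  arc_between (segment a b) a b.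
Proof.
move=> ab; split.
  exists [:: (a, b)]; apply/seteqP; split=> [x abx|x [p]].
    by exists (a, b) => //=; rewrite inE.
  by rewrite /= inE => /eqP ->.
exists (fun t => (1 - t) *: a + t *: b), (segment_coord a b); split => //.
- by move=> t _; exact: segment_coordK.
- have c1 (t : R) : (fun s : R => (1 - s) *: a) @ t --> (1 - t) *: a.
    by apply: cvgZr_tmp; apply: cvgB; [exact: cvg_cst|exact: cvg_id].
  have c2 (t : R) : (fun s : R => s *: b) @ t --> t *: b.
    by apply: cvgZr_tmp; exact: cvg_id.
  by apply: continuous_subspaceT => t; exact: cvgD (c1 t) (c2 t).
- by apply: continuous_subspaceT; exact: segment_coord_continuous.
- by rewrite subr0 subrr scale1r !scale0r scale1r addr0 add0r.
Qed.

(** Read through [segment_coord], any parametrisation of the segment becomes a continuous bijection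
    of [0, 1] onto itself, which sends ends to ends. *)
Lemma arc_between_segment_inv (R : realType) (a b x y : plane R) :
  arc_between (segment a b) x y -> [/\ x != y, [set a; b] x & [set a; b] y].
Proof.
case=> _ [f [g [fim fK fc _ [fx fy]]]].
have I0 : (0 : R) \in `[0, 1]%R by rewrite in_itv/= lexx ler01.
have I1 : (1 : R) \in `[0, 1]%R by rewrite in_itv/= lexx ler01.
have xy : x != y.
  apply/eqP => xy; have := fK _ I1; rewrite fy -xy -fx fK// => /esym/eqP.
  by rewrite oner_eq0.
(* A degenerate segment would make [f] constant, whereas x and y differ. *)
have ab : a != b.
  apply/eqP => ab; move: fim; rewrite ab => fim.
  have fb t : t \in `[0, 1]%R -> f t = b.
    move=> It; have : (segment b b) (f t) by rewrite -fim; exists t.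
    by case=> s _ <-; rewrite -scalerDl subrK scale1r.
  by move/eqP: xy; apply; rewrite -fx -fy !fb.
pose h := segment_coord a b \o f.
have fE t : t \in `[0, 1]%R -> f t = (1 - h t) *: a + h t *: b.
  move=> It; have : (segment a b) (f t) by rewrite -fim; exists t.
  by case=> s _; rewrite /h/= => <-; rewrite segment_coordK.
have hend t : t = 0 \/ t = 1 -> h t = 0 \/ h t = 1.
  apply: (@homeo_unit_interval_end _ h).
  - move=> s; exact: (@continuous_comp (subspace `[(0 : R), 1]) _ _ f _ s
      (fc s) (@segment_coord_continuous _ a b (f s))).
  - move=> s r Is Ir hst; rewrite -(fK _ Is) -(fK _ Ir); congr g.
    by rewrite !fE// hst.
  - apply/seteqP; split=> [_ [r Ir <-]|r Ir].
      have : (segment a b) (f r) by rewrite -fim; exists r.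
      by case=> s Is; rewrite /h/= => <-; rewrite segment_coordK.
    have : (f @` `[0, 1]) ((1 - r) *: a + r *: b) by rewrite fim; exists r.
    by case=> s Is fs; exists s => //; rewrite /h/= fs segment_coordK.
have fend t : t = 0 \/ t = 1 -> [set a; b] (f t).
  move=> tE; rewrite fE; last by case: tE => ->.
  case: (hend _ tE) => ->; [left|right];
  by rewrite ?subr0 ?subrr scale1r scale0r ?addr0 ?add0r.
by split=> //; rewrite -?fx -?fy; apply: fend; [left|right].
Qed.

Lemma endpoints_segment (R : realType) (a b : plane R) : a != b ->
  endpoints (segment a b) = [set a; b].
Proof.
move=> ab; apply/seteqP; split=> x.
  by case=> y [] /arc_between_segment_inv[].
case=> ->; [exists b|exists a]; [left|right]; exact: arc_between_segment.
Qed.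

(** * Edges, adjacency and countability *)

(** The endpoints of the arc given by [edges_arc] are two distinct extremities of the segment given
    by (P1), so both extremities are vertices and the segment is not degenerate. *)
Lemma edgeP (R : realType) (G : plane_graph R) (e : set (plane R)) :
  class_H G -> edges G e ->
  exists a b, [/\ a != b, vertices G a, vertices G b & e = segment a b].
Proof.
move=> hG Ge; have [a [b eE]] := H_segment hG Ge.
have [x [y [Vx Vy]]] := edges_arc Ge.
rewrite eE => /arc_between_segment_inv[xy xab yab].
exists a, b; split=> //.
- apply: contra xy => /eqP ab; apply/eqP.
  by move: xab yab; rewrite ab => -[]-> []->.
- by move: xy; case: xab Vx => [<-//|->] _;
  case: yab Vy => [<-//|->]; rewrite eqxx.
- by move: xy; case: xab Vx => [->|<-//] _;
  case: yab Vy => [->|<-//]; rewrite eqxx.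
Qed.

Lemma segmentl (R : realType) (a b : plane R) : segment a b a.
Proof.
by exists 0; rewrite /= ?in_itv/= ?lexx ?ler01// subr0 scale1r scale0r addr0.
Qed.

Lemma segmentr (R : realType) (a b : plane R) : segment a b b.
Proof. by rewrite segment_sym; exact: segmentl. Qed.

Lemma adjacentP (R : realType) (G : plane_graph R) (w u : plane R) :
  class_H G ->
  adjacent G w u <->
  [/\ u != w, vertices G u, vertices G w & edges G (segment u w)].
Proof.
move=> hG; split=> [[e Ge ewu]|[uw _ _ Guw]]; last first.
  by exists (segment u w) => //; rewrite endpoints_segment// setUC.
have [a [b [ab Va Vb eE]]] := edgeP hG Ge.
have E : [set a; b] = [set w; u] by rewrite -ewu eE endpoints_segment.
have [aw|aw] := eqVneq a w.
  have bu : b = u.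
    have : [set w; u] b by rewrite -E; right.
    by case=> //= bw; rewrite aw bw eqxx in ab.
  by split; rewrite -?aw -?bu// 1?eq_sym// segment_sym -eE.
have au : a = u.
  have : [set w; u] a by rewrite -E; left.
  by case=> //= aw'; rewrite aw' eqxx in aw.
have bw : b = w.
  have : [set a; b] w by rewrite E; left.
  by case=> //= wa; rewrite wa eqxx in aw.
by split; rewrite -?au -?bw// -eE.
Qed.

Lemma countable_edges (R : realType) (G : plane_graph R) :
  class_H G -> countable (edges G).
Proof.
move=> hG.
pose E := (fun p : plane R * plane R => segment p.1 p.2) @`
  (vertices G `*` vertices G).
apply: (@sub_countable _ _ _ E).
  apply: subset_card_le => e Ge; have [a [b [_ Va Vb ->]]] := edgeP hG Ge.
  by exists (a, b).
apply: sub_countable (card_image_le _ _) _.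
by apply: countableX; exact: countable_vertices.
Qed.

(** A countable set has Lebesgue measure 0, whereas the open interval from 0 to e has measure e. *)
Lemma notin_countable (R : realType) (C : set R) (e : R) :
  countable C -> 0 < e -> exists2 t, 0 < t < e & ~ C t.
Proof.
move=> cC e0; apply: contrapT => nC.
have sub : `]0, e[ `<=` C.
  move=> t; rewrite /= in_itv/= => t0e; apply: contrapT => nCt.
  by apply: nC; exists t.
have := countable_lebesgue_measure0 (sub_countable (subset_card_le sub) cC).
rewrite lebesgue_measure_itv/= lte_fin e0 oppr0 adde0 => -[e00].
by rewrite e00 ltxx in e0.
Qed.

(** * Lines, rays and transversal segments *)

(** The quarter turn of d: for nonzero d, the level sets of [dotp (perp d)] are the lines of
    direction d. *)
Definition perp (R : realType) (d : plane R) : plane R :=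
  \row_j (if j == 0 then - d 0 1 else d 0 0).

Lemma dotp_perpE (R : realType) (d x : plane R) :
  dotp (perp d) x = d 0 0 * x 0 1 - d 0 1 * x 0 0.
Proof. by rewrite dotpE !mxE/=; ring. Qed.

Lemma perp_neq0 (R : realType) (d : plane R) : d != 0 -> perp d != 0.
Proof.
apply: contra => /eqP/rowP p0; apply/eqP/rV2P; rewrite mxE.
  by have := p0 1; rewrite !mxE.
by have := p0 0; rewrite !mxE/= => /eqP; rewrite oppr_eq0 => /eqP.
Qed.

Lemma dotpD (R : realType) (n x y : plane R) :
  dotp n (x + y) = dotp n x + dotp n y.
Proof. by rewrite !dotpE !mxE; ring. Qed.

Lemma dotpZ (R : realType) (n x : plane R) (t : R) :
  dotp n (t *: x) = t * dotp n x.
Proof. by rewrite !dotpE !mxE; ring. Qed.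

Lemma dotp_perp_ray (R : realType) (u d : plane R) (t : R) :
  dotp (perp d) (u + t *: d) = dotp (perp d) u.
Proof. by rewrite !dotp_perpE !mxE; ring. Qed.

Lemma dotp_perp_inj (R : realType) (n x y : plane R) : n != 0 ->
  dotp n x = dotp n y -> dotp (perp n) x = dotp (perp n) y -> x = y.
Proof.
move=> /dotp_gt0; rewrite !dotp_perpE !dotpE => n0 h1 h2.
(* Since [n] and [perp n] are orthogonal of equal length, each coordinate times [dotp n n] is a
   combination of the two dot products. *)
apply: rV2P; apply: (mulfI (lt0r_neq0 n0)).
  transitivity (n 0 0 * (n 0 0 * x 0 0 + n 0 1 * x 0 1)
                - n 0 1 * (n 0 0 * x 0 1 - n 0 1 * x 0 0)); first by ring.
  by rewrite h1 h2; ring.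
transitivity (n 0 1 * (n 0 0 * x 0 0 + n 0 1 * x 0 1)
              + n 0 0 * (n 0 0 * x 0 1 - n 0 1 * x 0 0)); first by ring.
by rewrite h1 h2; ring.
Qed.

Lemma mem_line_ray (R : realType) (u d x : plane R) : d != 0 ->
  dotp (perp d) x = dotp (perp d) u -> exists t, x = u + t *: d.
Proof.
move=> d0 h; have dd := lt0r_neq0 (dotp_gt0 d0).
exists (dotp d (x - u) / dotp d d); apply: (dotp_perp_inj d0).
  by rewrite dotpD dotpZ divfK// -dotpD addrC subrK.
by rewrite dotp_perp_ray.
Qed.

Lemma ray_inj (R : realType) (u d : plane R) (s t : R) : d != 0 ->
  u + s *: d = u + t *: d -> s = t.
Proof.
by move=> d0 /addrI/eqP; rewrite -subr_eq0 -scalerBl scaler_eq0 (negbTE d0) orbF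
  subr_eq0 => /eqP.
Qed.

(** [dotp (perp d)] is affine along the segment; if it takes the value of the line at two distinct
    parameters, it is constant and the whole segment lies in the line. *)
Lemma segment_transversal (R : realType) (a b u d : plane R) (s t : R) :
  d != 0 ->
  ~ segment a b `<=` [set x | dotp (perp d) x = dotp (perp d) u] ->
  segment a b (u + s *: d) -> segment a b (u + t *: d) -> s = t.
Proof.
move=> d0 + [p _ ps] [q _ qt].
have [pq|pq] := eqVneq p q.
  by move=> _; apply: (ray_inj (u := u) d0); rewrite -ps -qt pq.
move=> nsub; exfalso; apply: nsub.
have := dotp_perp_ray u d s; have := dotp_perp_ray u d t.
rewrite -ps -qt !dotpD !dotpZ.
set A := dotp _ a; set B := dotp _ b; set c := dotp _ u => h1 h2.
have AB : A = B.
  have : (p - q) * (A - B) = 0 by lra.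
  move/eqP; rewrite mulf_eq0 !subr_eq0 (negbTE pq) /=; exact/eqP.
move=> _ [r _ <-]; rewrite /= dotpD !dotpZ -/A -/B -AB.
by move: h1; rewrite -AB; lra.
Qed.

(** * Neighbours along a ray *)

Lemma no_vertex_in_edge (R : realType) (G : plane_graph R) (u d : plane R)
    (r s t : R) : d != 0 -> r < s < t -> vertices G (u + s *: d) ->
  ~ edges G (segment (u + r *: d) (u + t *: d)).
Proof.
move=> d0 /andP[rs st] Vs Grt.
have : (arc_interior (segment (u + r *: d) (u + t *: d)) `&` vertices G)
         (u + s *: d).
  split=> //; split.
    have tr : t - r != 0 by rewrite gt_eqF// subr_gt0; exact: lt_trans st.
    exists ((s - r) / (t - r)).
      rewrite /= in_itv/= divr_ge0 ?ler_pdivrMr ?mul1r; lra.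
    by apply: rV2P; rewrite !mxE; field.
  rewrite endpoints_segment; last first.
    by apply/eqP => /(ray_inj d0) rt; move: st; rewrite -rt ltNge (ltW rs).
  by case=> /(ray_inj d0) E; rewrite E ltxx in rs st.
by rewrite interior_vertices.
Qed.

(** The edge [e] makes (P2) apply to the whole line, so it may lie on the other side of u; this is
    the case when d points away from a known neighbour. The edge sought is taken through a point of
    the ray close to u, then shown to start at u. *)
Lemma edge_along_ray (R : realType) (G : plane_graph R) (u d : plane R)
    (e : set (plane R)) :
  class_H G -> discrete_vertices G -> vertices G u -> d != 0 ->
  edges G e -> e `<=` [set x | dotp (perp d) x = dotp (perp d) u] ->
  exists s, [/\ 0 < s, vertices G (u + s *: d)
              & edges G (segment u (u + s *: d))].
Proof.
move=> hG hd Vu d0 Ge el; set l := [set x | _] in el.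
have [_ [V nV VE]] := hd _ Vu.
have [eps eps0 Veps] : exists2 eps : R, 0 < eps &
    forall t, 0 < t < eps -> V (u + t *: d).
  have c : (fun t : R => u + t *: d) @ (0 : R) --> u.
    rewrite -[X in _ --> X]addr0 -(scale0r d).
    apply: cvgD; first exact: cvg_cst.
    by apply: cvgZr_tmp; exact: cvg_id.
  have /nbhs_ballP[eps eps0 h] := c _ nV.
  exists eps => // t /andP[t0 te]; apply: h.
  by rewrite /ball/= sub0r normrN gtr0_norm.
(* The parameters at which edges not inside [l] meet it, at most one for each edge. At a parameter
   outside [C], the edge given by (P2) must lie inside [l]. *)
pose C := \bigcup_(f in [set f | edges G f /\ ~ f `<=` l])
  [set t : R | f (u + t *: d)].
have cC : countable C.
  apply: bigcup_countable.
    by apply: sub_countable (countable_edges hG); apply: subset_card_le => f [].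
  move=> f [Gf nfl]; have [a [b [_ _ _ fE]]] := edgeP hG Gf.
  have [[t0 ft0]|nft] := pselect (exists t : R, f (u + t *: d)).
    apply: (@sub_countable _ _ _ [set t0]); last exact: countable1.
    apply: subset_card_le => t ft.
    by rewrite fE in nfl ft0 ft; exact: (segment_transversal d0 nfl ft ft0).
  apply: (@sub_countable _ _ _ set0); last exact: countable0.
  by apply: subset_card_le => t ft; apply: nft; exists t.
have [t /andP[t0 te] nCt] := notin_countable cC eps0.
have ll : is_line l.
  by exists (perp d), (dotp (perp d) u); split=> //; exact: perp_neq0.
have [f Gf ft] := H_line hG Ge ll el (dotp_perp_ray u d t : l (u + t *: d)).
have fl : f `<=` l by apply: contrapT => nfl; apply: nCt; exists f.
(* Reduction to an edge whose ends are ordered along d; the other order follows by [segment_sym]. *)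
suff main a b al be : vertices G a -> vertices G b -> edges G (segment a b) ->
    a = u + al *: d -> b = u + be *: d -> al <= t <= be ->
    exists s, [/\ 0 < s, vertices G (u + s *: d)
              & edges G (segment u (u + s *: d))].
  have [a [b [_ Va Vb fE]]] := edgeP hG Gf.
  have [|al aE] := @mem_line_ray _ u d a d0.
    by apply: fl; rewrite fE; exact: segmentl.
  have [|be bE] := @mem_line_ray _ u d b d0.
    by apply: fl; rewrite fE; exact: segmentr.
  move: ft; rewrite fE => -[r]; rewrite /= in_itv/= => /andP[r0 r1].
  have -> : (1 - r) *: a + r *: b = u + ((1 - r) * al + r * be) *: d.
    by rewrite aE bE; apply: rV2P; rewrite !mxE; ring.
  move=> /(ray_inj d0) rt; rewrite fE in Gf.
  have [ab|/ltW ba] := leP al be.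
    by apply: (main a b al be) => //; rewrite -rt; apply/andP; split; nra.
  rewrite segment_sym in Gf.
  by apply: (main b a be al) => //; rewrite -rt; apply/andP; split; nra.
move=> Va Vb Gab aE bE /andP[alt tbe].
(* If a came before u, then u would be inside the edge. If a came after u, its parameter would be at
   most t, hence below [eps], and a would be a second vertex in [V]. So a is u. *)
have [al0|al0|al0] := ltgtP al 0.
- exfalso; rewrite aE bE in Gab.
  apply: (@no_vertex_in_edge _ G u d al 0 be d0 _ _ Gab).
    by rewrite al0 (lt_le_trans t0).
  by rewrite scale0r addr0.
- have : (V `&` vertices G) a.
    by split=> //; rewrite aE; apply: Veps; rewrite al0 (le_lt_trans alt).
  rewrite VE aE => /= /(canRL (addKr u))/eqP.
  by rewrite addNr scaler_eq0 (gt_eqF al0) (negbTE d0).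
- exists be; rewrite -bE; split=> //; first exact: lt_le_trans t0 tbe.
  by rewrite aE al0 scale0r addr0 in Gab.
Qed.

Lemma opposite_neighbour (R : realType) (G : plane_graph R) (w u : plane R) :
  class_H G -> discrete_vertices G -> adjacent G w u ->
  exists s, [/\ 0 < s, vertices G (u + s *: (u - w))
              & adjacent G (u + s *: (u - w)) u].
Proof.
move=> hG hd /(adjacentP _ _ hG)[uw Vu Vw Guw].
have d0 : u - w != 0 by rewrite subr_eq0.
have el : segment u w `<=`
    [set x | dotp (perp (u - w)) x = dotp (perp (u - w)) u].
  by move=> _ [t _ <-] /=; rewrite !dotp_perpE !mxE; ring.
have [s [s0 Vs Gs]] := edge_along_ray hG hd Vu d0 Guw el.
exists s; split=> //; apply/(adjacentP _ _ hG); split=> //.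
by rewrite -subr_eq0 opprD addNKr oppr_eq0 scaler_eq0 (gt_eqF s0).
Qed.

(** The nearer of two neighbours on one ray would be a vertex inside the edge to the farther one.
    This yields the injectivity of the map to opposite neighbours. *)
Lemma neighbour_ray_uniq (R : realType) (G : plane_graph R) (u d : plane R)
    (r s : R) : class_H G -> d != 0 -> 0 < r -> 0 < s ->
  adjacent G (u + r *: d) u -> adjacent G (u + s *: d) u -> r = s.
Proof.
move=> hG d0 r0 s0 /(adjacentP _ _ hG)[_ _ Vr Gr].
move=> /(adjacentP _ _ hG)[_ _ Vs Gs].
have uE : u = u + 0 *: d by rewrite scale0r addr0.
have [rs|sr|//] := ltgtP r s; exfalso.
  by apply: (@no_vertex_in_edge _ G u d 0 r s); rewrite -?uE ?r0.
by apply: (@no_vertex_in_edge _ G u d 0 s r); rewrite -?uE ?s0.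
Qed.

(** * Finite degrees, counting and maxima *)

Lemma finite_neighbours (R : realType) (G : plane_graph R) (u : plane R) :
  class_H G -> vertices G u ->
  finite_set [set w | vertices G w /\ adjacent G w u].
Proof.
move=> hG Vu; apply: contrapT => inf; have := H_degree hG.
suff -> : max_degree G = +oo%E by rewrite ltxx.
apply/eqP; rewrite eq_le leey /=; apply: ereal_sup_ubound; exists u => //.
(* [counting] is +oo on an infinite set. *)
by rewrite /deg /counting asboolF.
Qed.

Lemma counting_le_inj (R : realType) (T : choiceType) (A B : set T)
    (f : T -> T) :
  finite_set B -> {in A &, injective f} -> f @` A `<=` B ->
  (counting A <= counting B :> \bar R)%E.
Proof.
move=> finB fi AB.
have cAB : (A #<= B)%card.
  apply: card_le_trans (subset_card_le AB).
  by move: (inj_card_eq fi); rewrite card_eq_sym card_eq_le => /andP[].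
rewrite /counting !asboolT//; last exact: card_le_finite cAB finB.
rewrite lee_fin ler_nat; have [n Bn] := (finite_setP _).1 finB.
rewrite (card_fset_set Bn); apply: geq_card_fset_set.
by rewrite -(card_le_eqr Bn).
Qed.

Lemma finite_set_argmax (R : realType) (T : eqType) (A : set T) (f : T -> R) :
  finite_set A -> A !=set0 -> exists2 u, A u & forall x, A x -> f x <= f u.
Proof.
move=> /finite_seqP[s ->] {A} [x0]; elim: s x0 => [//|a s IH] x0 _.
have [sE|[b bs]] : s = [::] \/ exists b, b \in s.
- by case: (s) => [|b s']; [left|right; exists b; rewrite mem_head].
- by exists a => [|x]; rewrite sE /= inE// => /eqP ->.
have [u us umax] := IH b bs; have [fau|fua] := leP (f a) (f u).
  by exists u => [|x]; rewrite /= inE ?us ?orbT// => /orP[/eqP->//|/umax].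
exists a => [|x]; rewrite /= inE ?eqxx// => /orP[/eqP->//|/umax xu].
exact: le_trans xu (ltW fua).
Qed.

Lemma finite_set_lexmax (R : realType) (T : eqType) (A : set T) (f g : T -> R) :
  finite_set A -> A !=set0 ->
  exists2 u, A u & forall x, A x -> f x <= f u /\ (f x = f u -> g x <= g u).
Proof.
move=> finA A0; have [v Av vmax] := finite_set_argmax f finA A0.
have [||u [Au fuv] umax] :=
  @finite_set_argmax _ _ (A `&` [set x | f x = f v]) g.
- exact: finite_setIl.
- by exists v.
exists u => // x Ax; rewrite fuv; split=> [|fxv]; first exact: vmax.
exact: umax.
Qed.

(** * The shrink property at a lexicographic maximum *)

Theorem theorem5 (R : realType) (G : plane_graph R)
  (hG : class_H G) (hd : discrete_vertices G) : planar_shrink G.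
Proof.
move=> S l H SV _ _ [n [c [n0 _ HE]]] SH0 finSH.
have [u [Su Hu] umax] := finite_set_lexmax (dotp n) (dotp (perp n)) finSH SH0.
exists u => //; have Vu := SV _ Su.
have cu : c <= dotp n u by move: Hu; rewrite HE.
have nS w s : S w -> w != u -> 0 < s -> ~ S (u + s *: (u - w)).
  move=> Sw wu s0 Sw'.
  (* If w is outside [H], then [dotp n w] is below c, hence below [dotp n u]; if w is in [H],
     maximality of u applies. *)
  have nw : dotp n w <= dotp n u.
    have [cw|cw] := leP c (dotp n w); last exact: le_trans (ltW cw) cu.
    by case: (umax w) => //; split=> //; rewrite HE.
  have E m : dotp m (u + s *: (u - w)) = dotp m u + s * (dotp m u - dotp m w).
    by rewrite !dotpE !mxE; ring.
  have Hw' : H (u + s *: (u - w)).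
    by rewrite HE /= E; apply: le_trans cu _;
      rewrite lerDl mulr_ge0 ?subr_ge0// ltW.
  (* Comparing u with the opposite point gives the inequality reverse to [nw], so w is level with u
     and lies in [H]. The same two comparisons for [perp n] then force w to equal u. *)
  have [] := umax _ (conj Sw' Hw').
  rewrite !E gerDl pmulr_rle0// subr_le0 => nu.
  have nE : dotp n w = dotp n u by apply/le_anti; rewrite nw.
  rewrite nE subrr mulr0 addr0 => /(_ erefl).
  rewrite gerDl pmulr_rle0// subr_le0 => pu.
  have Hw : H w by rewrite HE /= nE.
  have [_ /(_ nE) pw] := umax _ (conj Sw Hw).
  move/eqP: wu; apply; apply: (dotp_perp_inj n0 nE).
  by apply/le_anti; rewrite pw.
(* The value u at points that are not neighbours in S is arbitrary. *)
have /choice[f fP] w : exists w', S w /\ adjacent G w u -> exists s,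
    [/\ 0 < s, w' = u + s *: (u - w), vertices G w' & adjacent G w' u].
  have [[Sw wu]|nw] := pselect (S w /\ adjacent G w u); last by exists u.
  have [s [s0 Vs us]] := opposite_neighbour hG hd wu.
  by exists (u + s *: (u - w)) => _; exists s.
apply: (@counting_le_inj _ _ _ _ f).
- by apply: sub_finite_set (finite_neighbours hG Vu) => w [[Vw _] wu].
- move=> w1 w2 /set_mem Sw1 /set_mem Sw2.
  have [s1 [s10 -> _ _]] := fP _ Sw1; have [s2 [s20 -> _ _]] := fP _ Sw2.
  move=> /addrI E.
  have [/[dup] aw1 /(adjacentP _ _ hG)[uw1 _ _ _] aw2] := (Sw1.2, Sw2.2).
  (* Equal images mean s1 (u - w1) = s2 (u - w2), so w1 and w2 are neighbours of u on one ray, at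
     parameters 1 and s1 / s2. *)
  have w1E : w1 = u + 1 *: (w1 - u) by rewrite scale1r addrC subrK.
  have w2E : w2 = u + (s1 / s2) *: (w1 - u).
    rewrite mulrC -scalerA -[w1 - u]opprB scalerN E -scalerN
      scalerA mulVf ?gt_eqF//.
    by rewrite scale1r opprB addrC subrK.
  have := @neighbour_ray_uniq _ G u (w1 - u) 1 (s1 / s2) hG.
  rewrite -w1E -w2E => r; rewrite w2E -r// ?divr_gt0//;
    by rewrite ?subr_eq0 // eq_sym.
- move=> _ [w Sw <-]; have [s [s0 wE Vw' aw']] := fP _ Sw.
  split=> //; split=> //; rewrite wE; apply: nS => //; first exact: Sw.1.
  by have /(adjacentP _ _ hG)[uw _ _ _] := Sw.2; rewrite eq_sym.
Qed.
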